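(* Let $k\ge 2$ and $n\ge 1$ be integers. For $C>0$, let $\boldsymbol d_{B,C}$ be the Bayes estimator of the multinomial parameter $\boldsymbol\theta\in E_k$ under the prior $\mathrm{Dir}(C,\dots,C)$ and squared error loss, based on a sample of size $n$, and let $\boldsymbol{\hat\theta}$ be the maximum likelihood estimator. Let $\bar R_{\boldsymbol{\hat\theta}}$ and $\bar R_{\boldsymbol d_{B,C}}$ be the averages of their risk functions over $E_k$ with respect to the volume measure. Then the average decrease in risk in proportion to the average risk of the MLE is $$\frac{\bar R_{\boldsymbol{\hat\theta}}-\bar R_{\boldsymbol d_{B,C}}}{\bar R_{\boldsymbol{\hat\theta}}}=1-\frac{n(kC^2+n)}{(kC+n)^2},$$ and, for fixed $k$ and $n$, this quantity as a function of $C>0$ has a global maximum at $C=1$ (the uniform prior), where its value is $\frac{k}{k+n}$.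
   Context: The parameter space is the simplex $E_k=\{\boldsymbol\theta=(\theta_1,\dots,\theta_k)\in\mathbb{R}^k:\ \theta_i\ge 0\ \forall i,\ \sum_{i=1}^k\theta_i=1\}$, equipped with $(k-1)$-dimensional volume measure (surface area). The observation is the vector of class counts $(n_1,\dots,n_k)$, with $n_i$ nonnegative integers summing to $n$, having the multinomial distribution with probability mass function $\frac{n!}{n_1!\cdots n_k!}\theta_1^{n_1}\cdots\theta_k^{n_k}$ (with $0^0=1$). The maximum likelihood estimator is $\boldsymbol{\hat\theta}=(n_1/n,\dots,n_k/n)$. The Dirichlet prior $\mathrm{Dir}(\alpha_1,\dots,\alpha_k)$ (all $\alpha_i>0$) has density proportional to $\theta_1^{\alpha_1-1}\cdots\theta_k^{\alpha_k-1}$ on the simplex. Under the prior $\mathrm{Dir}(C,\dots,C)$ and squared error loss the Bayes estimator (posterior mean) $\boldsymbol d_{B,C}$ has $i$-th coordinate $\frac{n_i+C}{n+kC}$. The risk of an estimator $\boldsymbol d$ at $\boldsymbol\theta$ is $R(\boldsymbol d,\boldsymbol\theta)=E_{\boldsymbol\theta}\left[\sum_{i=1}^k(d_i-\theta_i)^2\right]$, the expectation being over the multinomial distribution of $(n_1,\dots,n_k)$ with parameter $\boldsymbol\theta$. The average risk is $\bar R_{\boldsymbol d}=\frac{\int_{E_k}R(\boldsymbol d,\boldsymbol\theta)\,d\boldsymbol\theta}{\mathrm{Vol}(E_k)}$, with integration and $\mathrm{Vol}$ with respect to the $(k-1)$-dimensional volume measure on $E_k$. *)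

(* Defs.v *)
From HB Require Import structures.
From mathcomp Require Import all_boot all_order all_algebra.
From mathcomp Require Import all_classical all_reals all_analysis.
From mathcomp Require Import measurable_realfun.

Set Implicit Arguments.
Unset Strict Implicit.
Unset Printing Implicit Defensive.
Import Order.TTheory GRing.Theory Num.Theory.

Local Open Scope classical_set_scope.
Local Open Scope ring_scope.

(* R^n as n-tuples over R with its Borel sigma-algebra ([measurableTypeR R] is
   convertible to R); tuples carry the product sigma-algebra. *)
Notation vec R n := (n.-tuple (measurableTypeR R)).

Definition coord (R : realType) (n : nat) (x : vec R n) (i : 'I_n) : R :=
  tnth x i.

(* Lebesgue measure on R^n, by induction on n: the image of
    lebesgue_measure \x (Lebesgue measure on R^n) under (x, t) |-> x :: t. *)

Definition vec_cons (R : realType) (n : nat) (p : measurableTypeR R * vec R n) :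
  vec R n.+1 := [tuple of p.1 :: p.2].

Lemma measurable_vec_cons (R : realType) (n : nat) :
  measurable_fun setT (@vec_cons R n).
Proof. exact: measurable_cons. Qed.

HB.instance Definition _ (R : realType) (n : nat) :=
  isMeasurableFun.Build _ _ _ _ (@vec_cons R n) (@measurable_vec_cons R n).

Section LebesgueStep.
Context (R : realType) (n : nat).
Variable mu : {sigma_finite_measure set (vec R n) -> \bar R}.

Definition lebesgue_step : set (vec R n.+1) -> \bar R :=
  pushforward (@lebesgue_measure R \x mu)%E (@vec_cons R n).

Let step0 : lebesgue_step set0 = 0%E.
Proof. exact: measure0. Qed.

Let step_ge0 A : (0 <= lebesgue_step A)%E.
Proof. exact: measure_ge0. Qed.

Let step_sigma_additive : semi_sigma_additive lebesgue_step.
Proof. exact: measure_semi_sigma_additive. Qed.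

HB.instance Definition _ := isMeasure.Build _ _ _ lebesgue_step
  step0 step_ge0 step_sigma_additive.

Let step_sigma_finite : sigma_finite setT lebesgue_step.
Proof.
have /sigma_finiteP[F [FT ndF Foo]] := sigma_finiteT (@lebesgue_measure R).
have /sigma_finiteP[G [GT ndG Goo]] := sigma_finiteT mu.
pose uncons (t : vec R n.+1) : measurableTypeR R * vec R n :=
  (tnth t ord0, [tuple of behead t]).
have consK : cancel (@vec_cons R n) uncons.
  by move=> [x t]; rewrite /uncons; congr (_, _); exact/val_inj.
have unconsK : cancel uncons (@vec_cons R n).
  by move=> t; rewrite /vec_cons /uncons /= -tuple_eta.
have muncons : measurable_fun setT uncons.
  apply/measurable_fun_pairP; split; first exact: measurable_tnth.
  exact: measurable_behead.
exists (fun i => uncons @^-1` (F i `*` G i)).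
  rewrite -preimage_bigcup [X in _ @^-1` X](_ : _ = setT) ?preimage_setT//.
  rewrite -subTset => -[x y] _.
  have [i _ Fix] : (\bigcup_i F i) x by rewrite -FT.
  have [j _ Gjy] : (\bigcup_i G i) y by rewrite -GT.
  exists (maxn i j) => //; split => /=.
  - by move: x Fix; exact/subsetPset/ndF/leq_maxl.
  - by move: y Gjy; exact/subsetPset/ndG/leq_maxr.
move=> i; have [mF Fi] := Foo i; have [mG Gi] := Goo i; split.
  by rewrite -[X in measurable X]setTI; apply: muncons => //; exact: measurableX.
rewrite /lebesgue_step /pushforward -comp_preimage.
rewrite (_ : uncons \o _ = id) ?preimage_id; last exact/funext.
by rewrite product_measure1E// lte_mul_pinfty// ge0_fin_numE.
Qed.

HB.instance Definition _ := Measure_isSigmaFinite.Build _ _ _ lebesgue_step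
  step_sigma_finite.

End LebesgueStep.

Fixpoint lebesgue_vec (R : realType) (n : nat) :
    {sigma_finite_measure set (vec R n) -> \bar R} :=
  match n return {sigma_finite_measure set (vec R n) -> \bar R} with
  | 0%N => \d_([tuple] : vec R 0)
  | m.+1 => lebesgue_step (lebesgue_vec R m)
  end.

Definition simplex (R : realType) (k : nat) : set (vec R k) :=
  [set t | (forall i, 0 <= coord t i) /\ \sum_(i < k) coord t i = 1].

(* The affine chart (t_1, ..., t_(k-1)) |-> (t_1, ..., t_(k-1), 1 - sum t_i)
   of the hyperplane sum t_i = 1; the last coordinate is the default of nth. *)
Definition chart (R : realType) (k : nat) (t : vec R k.-1) : vec R k :=
  [tuple (nth (1 - \sum_j coord t j) t i : measurableTypeR R) | i < k].

Lemma measurable_chart (R : realType) (k : nat) :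
  measurable_fun setT (@chart R k).
Proof.
apply/measurable_fun_tnthP => i.
have [ik|ki] := ltnP i k.-1.
- rewrite (_ : _ \o _ = @tnth _ _ ^~ (Ordinal ik)); first exact: measurable_tnth.
  by apply/funext => t; rewrite /= tnth_mktuple (tnth_nth (1 - \sum_j coord t j)).
- rewrite (_ : _ \o _ = fun t : vec R k.-1 => 1 - \sum_j coord t j); last first.
    by apply/funext => t; rewrite /= tnth_mktuple nth_default// size_tuple.
  apply: measurable_funB => //; apply: measurable_sum => j.
  exact: measurable_tnth.
Qed.

HB.instance Definition _ (R : realType) (k : nat) :=
  isMeasurableFun.Build _ _ _ _ (@chart R k) (@measurable_chart R k).

Section SimplexVolume.
Context (R : realType) (k : nat).

Definition chart_image : set (vec R k) -> \bar R :=
  pushforward (lebesgue_vec R k.-1) (@chart R k).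

Let chart_image0 : chart_image set0 = 0%E.
Proof. exact: measure0. Qed.

Let chart_image_ge0 A : (0 <= chart_image A)%E.
Proof. exact: measure_ge0. Qed.

Let chart_image_sigma_additive : semi_sigma_additive chart_image.
Proof. exact: measure_semi_sigma_additive. Qed.

HB.instance Definition _ := isMeasure.Build _ _ _ chart_image
  chart_image0 chart_image_ge0 chart_image_sigma_additive.

(* Surface measure on the hyperplane sum t_i = 1. The Jacobian of the chart is
   J = (I | -1), with Gram determinant det (J J^T) = det (I + 1 1^T) = k, hence
   the area element is sqrt k times Lebesgue measure on R^(k-1). *)
Definition simplex_volume : {measure set (vec R k) -> \bar R} :=
  mscale (Num.sqrt k%:R)%:nng chart_image.

End SimplexVolume.

Definition simplex_integral (R : realType) (k : nat) (f : vec R k -> R) : R :=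
  \int[@simplex_volume R k]_(t in @simplex R k) f t.

Definition simplex_average (R : realType) (k : nat) (f : vec R k -> R) : R :=
  simplex_integral f / fine (@simplex_volume R k (@simplex R k)).

Definition counts (k n : nat) : finType :=
  {c : {ffun 'I_k -> 'I_n.+1} | (\sum_(i < k) c i == n)%N}.

Definition count_of (k n : nat) (c : counts k n) (i : 'I_k) : nat := val c i.

Definition multinomial_pmf (R : realType) (k n : nat) (t : vec R k)
    (c : counts k n) : R :=
  n`!%:R / (\prod_(i < k) (count_of c i)`!)%N%:R
    * \prod_(i < k) coord t i ^+ count_of c i.

Definition multinomial_expectation (R : realType) (k n : nat) (t : vec R k)
    (f : counts k n -> R) : R :=
  \sum_(c : counts k n) multinomial_pmf t c * f c.

Definition estimator (R : realType) (k n : nat) := counts k n -> 'I_k -> R.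

Definition risk (R : realType) (k n : nat) (d : estimator R k n)
    (t : vec R k) : R :=
  multinomial_expectation t
    (fun c : counts k n => \sum_(i < k) (d c i - coord t i) ^+ 2).

Definition average_risk (R : realType) (k n : nat) (d : estimator R k n) : R :=
  simplex_average (risk d).

Definition mle (R : realType) (k n : nat) : estimator R k n :=
  fun c i => (count_of c i)%:R / n%:R.

(* [powR] gives the density a finite value where some coordinate vanishes and
   the exponent is negative; this set is negligible for [simplex_volume]. *)
Definition dirichlet_kernel (R : realType) (k : nat) (a : 'I_k -> R)
    (t : vec R k) : R :=
  \prod_(i < k) coord t i `^ (a i - 1).

Definition dirichlet_density (R : realType) (k : nat) (a : 'I_k -> R)
    (t : vec R k) : R :=
  dirichlet_kernel a t / simplex_integral (dirichlet_kernel a).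

Definition posterior_density (R : realType) (k n : nat) (prior : vec R k -> R)
    (c : counts k n) (t : vec R k) : R :=
  multinomial_pmf t c * prior t
    / simplex_integral (fun s => multinomial_pmf s c * prior s).

(* For squared error loss the posterior expected loss is minimized by the
   posterior mean. *)
Definition bayes_estimator (R : realType) (k n : nat) (prior : vec R k -> R) :
    estimator R k n :=
  fun c i => simplex_integral (fun t => coord t i * posterior_density prior c t).

Definition bayes_dirichlet (R : realType) (k n : nat) (C : R) :
    estimator R k n :=
  bayes_estimator (dirichlet_density (fun=> C)).

Definition relative_decrease (R : realType) (k n : nat) (C : R) : R :=
  (average_risk (@mle R k n) - average_risk (@bayes_dirichlet R k n C))
    / average_risk (@mle R k n).

(* Main.v *)
From HB Require Import structures.
Require Import Defs.
From mathcomp Require Import all_boot all_order all_algebra.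
From mathcomp Require Import all_classical all_reals all_analysis.
From mathcomp Require Import measurable_realfun ring lra.
Import Order.TTheory GRing.Theory Num.Theory.
Import numFieldNormedType.Exports.
Local Open Scope ring_scope.

(* Everything reduces to the recurrence I(a + e_i) = a_i / (sum a) I(a) for the
   Dirichlet integral I(a) over the simplex. In the affine chart, integrating out
   one coordinate at a time turns I(a) into an iterated convolution of power
   functions x^(a-1); by scaling, the convolution of x^(a-1) and x^(b-1) is
   B(a,b) x^(a+b-1), so I(a) is a product of beta integrals, and their recurrence
   follows from associativity of convolution with the unit step.
   The recurrence gives the posterior mean (n_i + C)/(n + kC) and the average
   2/(k+1) of S = sum theta_i^2. With the multinomial moments, the risk of
   (n_i + C)/(n + kC) is (n (1 - S) + C^2 (k^2 S - k)) / (n + kC)^2, whose average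
   is (k-1)/(k+1) (n + k C^2)/(n + kC)^2; the MLE is the case C = 0. The deficit
   with respect to C = 1 is a nonnegative multiple of (C - 1)^2. *)

(** * Beta integrals with real exponents *)

Section AffineSubstitution.
Local Open Scope classical_set_scope.
Local Open Scope ring_scope.
Context {R : realType}.
Local Notation mu := (@lebesgue_measure R).
Implicit Types (c d : R) (f : R -> \bar R).

Lemma measurable_affine c d :
  measurable_fun setT (fun x : R => c * x + d : R).
Proof. by apply: measurable_funD => //; apply: measurable_funM. Qed.

(** The measure [c] times the image of Lebesgue measure under [x |-> c * x + d] gives half-open
    intervals their length, so by uniqueness it is Lebesgue measure. *)
Lemma ge0_integral_scale_shift c d f : 0 < c ->
  measurable_fun setT f -> (forall x, 0 <= f x)%E ->
  (\int[mu]_x f x = c%:E * \int[mu]_x f (c * x + d)%R)%E.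
Proof.
move=> c0 mf f0.
have mphi : measurable_fun setT
    ((fun x => c * x + d) : measurableTypeR R -> measurableTypeR R).
  exact: measurable_affine.
have -> : (\int[mu]_x f (c * x + d)%R =
    \int[pushforward mu
      (fun x : measurableTypeR R => (c * x + d : measurableTypeR R)%R)]_x f x)%E.
  by rewrite ge0_integral_pushforward.
pose nu : {measure set (measurableTypeR R) -> \bar R} :=
  measure_function_pushforward__canonical__measure_function_Measure mu mphi.
have c0' : 0 <= c by exact: ltW.
pose c' := NngNum c0'.
rewrite -[c%:E]/((c'%:num)%:E) -[in RHS](@ge0_integral_mscale _ _ _ nu)//.
apply: eq_measure_integral => A mA _.
apply: lebesgue_measure_unique => // _ [[a b]] _ <- /=.
rewrite /mscale/= /nu /pushforward/=.
rewrite (_ : _ @^-1` _ = `](a - d) / c, (b - d) / c]%classic); last first.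
  apply/seteqP; split => x /=; rewrite !in_itv/= => /andP[h1 h2]; apply/andP.
    by rewrite ltr_pdivrMr// ler_pdivlMr// ltrBlDr lerBrDr ![x * c]mulrC.
  by move: h1 h2; rewrite ltr_pdivrMr// ler_pdivlMr// ltrBlDr lerBrDr ![x * c]mulrC.
rewrite !lebesgue_measure_itv/= !lte_fin ltr_pM2r ?invr_gt0// ltrD2r.
case: ifPn => ab; last by rewrite mule0.
by rewrite -!EFinB -EFinM; congr EFin; field; rewrite gt_eqF.
Qed.

Lemma ge0_integral_opp f :
  measurable_fun setT f -> (forall x, 0 <= f x)%E ->
  (\int[mu]_x f x = \int[mu]_x f (- x)%R)%E.
Proof.
move=> mf f0.
have -> : (\int[mu]_x f (- x)%R =
    \int[pushforward mu (-%R : measurableTypeR R -> measurableTypeR R)]_x f x)%E.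
  by rewrite ge0_integral_pushforward.
by apply: eq_measure_integral => A mA _; apply/esym; exact: lebesgue_measureN.
Qed.

End AffineSubstitution.

(** * Convolution of power functions and the beta recurrence *)

Section PowerConvolution.
Local Open Scope classical_set_scope.
Local Open Scope ring_scope.
Context {R : realType}.
Local Notation mu := (@lebesgue_measure R).
Implicit Types a b s x : R.

(** Extension by zero turns convolutions on the half-line into integrals over the whole line, with
    no bounds to track. *)
Definition power_density a x : R := if 0 < x then x `^ (a - 1) else 0.
Local Notation w := power_density.

Lemma power_density_ge0 a x : 0 <= w a x.
Proof. by rewrite /w; case: ifP => // _; exact: powR_ge0. Qed.

Lemma power_density_scale a s x : 0 < s -> w a (s * x) = s `^ (a - 1) * w a x.
Proof.
move=> s0; rewrite /w pmulr_rgt0//; case: ifP => x0; last by rewrite mulr0.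
by rewrite powRM// ltW.
Qed.

Lemma power_density_nonincreasing a b x : a <= b -> x <= 1 -> w b x <= w a x.
Proof.
move=> ab x1; rewrite /w; case: ifP => // x0.
by apply: ger_powR; rewrite ?x0// lerD2r.
Qed.

Lemma measurable_power_density a : measurable_fun setT (w a).
Proof.
apply: measurable_fun_if => //.
- by apply: measurable_fun_ltr.
- by apply: measurable_funTS; exact: measurable_powR.
Qed.

Lemma measurable_power_densityB a s : measurable_fun setT (fun x => w a (s - x)).
Proof.
apply: (measurableT_comp (measurable_power_density a)).
exact: measurable_funB.
Qed.

Definition power_conv a b s : \bar R := (\int[mu]_x (w a x * w b (s - x))%:E)%E.

(** Extended-real valued, so that Tonelli applies before finiteness is known; finiteness is then
    deduced from the recurrence itself. *)
Definition ebeta a b : \bar R := power_conv a b 1.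

Lemma measurable_power_conv_integrand a b s :
  measurable_fun setT (fun x => (w a x * w b (s - x))%:E).
Proof.
apply/measurable_EFinP; apply: measurable_funM.
  exact: measurable_power_density.
exact: measurable_power_densityB.
Qed.

Lemma power_conv_integrand_ge0 a b s x : (0 <= (w a x * w b (s - x))%:E)%E.
Proof. by rewrite lee_fin mulr_ge0// power_density_ge0. Qed.

Lemma ebeta_ge0 a b : (0 <= ebeta a b)%E.
Proof. by apply: integral_ge0 => x _; exact: power_conv_integrand_ge0. Qed.

(** For [0 < s], substitute [s * x] for [x]: the two densities give [s] to the powers [a - 1] and
    [b - 1], and the Jacobian one more [s]. For [s <= 0] the factors have disjoint supports and both
    sides vanish. *)
Lemma power_convE a b s : power_conv a b s = ((w (a + b) s)%:E * ebeta a b)%E.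
Proof.
have [s0|s0] := ltP 0 s; last first.
  rewrite /w ltNge s0/= mul0e; apply: integral0_eq => x _.
  rewrite /w; case: ifPn => x0; last by rewrite mul0r.
  by rewrite ifF ?mulr0//; apply/negbTE; rewrite -leNgt; lra.
rewrite /power_conv (ge0_integral_scale_shift s 0 _ s0); last 2 first.
- exact: measurable_power_conv_integrand.
- by move=> x; exact: power_conv_integrand_ge0.
under eq_integral => x _.
  rewrite addr0 (_ : s - s * x = s * (1 - x)); last by ring.
  rewrite !power_density_scale// mulrACA EFinM.
  over.
rewrite ge0_integralZl//; last 3 first.
- exact: measurable_power_conv_integrand.
- by move=> x _; exact: power_conv_integrand_ge0.
- by rewrite lee_fin mulr_ge0// powR_ge0.
rewrite muleA -EFinM; congr (_%:E * _)%E.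
rewrite /w s0 -powRD; last by rewrite (gt_eqF s0) implybT.
rewrite -{1}[s]powRr1 ?ltW// -powRD; last by rewrite (gt_eqF s0) implybT.
by congr (_ `^ _); ring.
Qed.

(** Reflection of [x] into [1 - x], obtained as a change of sign followed by a translation. *)
Lemma ebeta_sym a b : ebeta a b = ebeta b a.
Proof.
rewrite /ebeta /power_conv ge0_integral_opp; last 2 first.
- exact: measurable_power_conv_integrand.
- by move=> x; exact: power_conv_integrand_ge0.
rewrite (@ge0_integral_scale_shift _ 1 (-1))//; last 2 first.
- apply: (measurableT_comp (measurable_power_conv_integrand a b 1)).
  exact: measurable_funN.
- by move=> x; exact: power_conv_integrand_ge0.
rewrite mul1e; apply: eq_integral => x _; congr EFin.
by rewrite mulrC; congr (w _ _ * w _ _); ring.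
Qed.

Lemma integral_powR_itv a (e : R) : 0 < a -> 0 < e -> e < 1 ->
  (\int[mu]_(x in `[e, 1%R]) (x `^ (a - 1))%:E = (a^-1 * (1 - e `^ a))%:E)%E.
Proof.
move=> a0 e0 e1.
have e1_gt0 x : x \in `[e, 1] -> 0 < x.
  by rewrite in_itv/= => /andP[ex _]; exact: lt_le_trans ex.
have dpow (p x : R) : 0 < x -> derivable (fun x => x `^ p : R) x 1.
  by move=> x0; apply: derivable_powR; rewrite in_itv/= x0.
have cpow (p x : R) : 0 < x -> {for x, continuous (fun x => x `^ p : R)}.
  by move=> x0; apply/differentiable_continuous/derivable1_diffP; exact: dpow.
have dF x : 0 < x -> derivable (fun x => a^-1 * x `^ a : R) x 1.
  by move=> x0; apply: derivableM => //; exact: dpow.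
have cF x : 0 < x -> {for x, continuous (fun x => a^-1 * x `^ a : R)}.
  by move=> x0; apply/differentiable_continuous/derivable1_diffP; exact: dF.
rewrite (@continuous_FTC2 _ _ (fun x => a^-1 * x `^ a))//.
- by rewrite powR1 -EFinB mulrBr.
- apply: continuous_in_subspaceT => x /set_mem /=/e1_gt0 x0.
  exact: cpow.
- split.
  + move=> x; rewrite in_itv/= => /andP[ex _].
    by apply: dF; exact: lt_trans ex.
  + by apply: cvg_at_right_filter; exact: cF.
  + by apply: cvg_at_left_filter; apply: cF.
- move=> x; rewrite in_itv/= => /andP[ex _].
  have x0 : 0 < x by exact: lt_trans ex.
  rewrite derive1E deriveM//; last exact: dpow.
  rewrite derive_cst scaler0 addr0.
  have [_ ->] := is_derive1_powR a x0.
  by rewrite /GRing.scale/= mulrA mulVf ?gt_eqF// mul1r.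
Qed.

Lemma ebeta_1 a : 0 < a -> ebeta a 1 = (a^-1)%:E.
Proof.
move=> a0.
have -> : ebeta a 1 = (\int[mu]_(x in `]0%R, 1%R[) (x `^ (a - 1))%:E)%E.
  rewrite [RHS]integral_mkcond; apply: eq_integral => x _.
  rewrite patchE; case: ifPn; rewrite /w.
    by rewrite inE/= in_itv/= => /andP[-> x1]; rewrite subr_gt0 x1 subrr powRr0 mulr1.
  rewrite notin_setE/= in_itv/= => /negP; rewrite negb_and.
  case: (ltP 0 x) => x0 /=; last by rewrite mul0r.
  by rewrite subr_gt0 => /negbTE ->; rewrite mulr0.
have mpow : measurable_fun setT (fun x : R => (x `^ (a - 1))%:E).
  by apply/measurable_EFinP; exact: measurable_powR.
rewrite -(@integral_itv_bndoo _ 0 1 _ false false)/=; last first.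
  by apply: measurable_funTS.
(* Starting at [n.+2] keeps the left endpoint strictly below 1, as [integral_powR_itv] requires. *)
pose F n : set R := `[n.+2%:R^-1, 1]%classic.
have F_bigcup : `]0%R, 1%R]%classic = \bigcup_n F n.
  apply/seteqP; split => x /=.
    rewrite in_itv/= => /andP[x0 x1]; exists (Num.truncn x^-1) => //=.
    rewrite /F/= in_itv/= x1 andbT invf_ple ?posrE//.
    by rewrite (le_trans (ltW (Num.Theory.truncnS_gt _)))// ler_nat.
  move=> [n _]; rewrite /F/= !in_itv/= => /andP[nx ->]; rewrite andbT.
  by apply: lt_le_trans nx; rewrite invr_gt0.
rewrite F_bigcup.
have F_nd : nondecreasing_seq F.
  move=> m p mp; apply/subsetPset; apply: subset_itvr.
  by rewrite bnd_simp lef_pV2 ?posrE// ler_nat.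
have Fcvg : (\int[mu]_(x in F i) (x `^ (a - 1))%:E @[i --> \oo] -->
    \int[mu]_(x in \bigcup_i F i) (x `^ (a - 1))%:E)%E.
  apply: ge0_nondecreasing_set_cvg_integral => //.
  - by move=> n; exact: measurable_itv.
  - by move=> n; exact: measurable_funTS.
  - by move=> n x _; rewrite lee_fin powR_ge0.
apply: (cvg_unique _ Fcvg) => //.
have intE n : (\int[mu]_(x in F n) (x `^ (a - 1))%:E =
    (a^-1 * (1 - n.+2%:R^-1 `^ a))%:E)%E.
  by rewrite integral_powR_itv// ?invr_gt0// invf_lt1// ltr1n.
rewrite /=; under eq_cvg do rewrite intE.
apply: cvg_EFin; first exact: nearW.
rewrite -[X in _ --> X]mulr1; apply: cvgM; first exact: cvg_cst.
rewrite -[X in _ --> X]subr0; apply: cvgB; first exact: cvg_cst.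
have /cvg_at_rightP := powR_cvg0 a0; apply; split.
  by move=> n; rewrite invr_gt0.
have := @cvg_harmonic R; rewrite -cvg_shiftS.
exact: cvg_trans.
Qed.

(* Both sides are the triple convolution of the densities of exponents a, b, 1 at
   the point 1; this gives the beta recurrence without integrating by parts. *)
Lemma ebeta_assoc a b : 0 < a -> 0 < b ->
  (ebeta a b * ((a + b)^-1)%:E = ebeta a (b + 1) * (b^-1)%:E)%E.
Proof.
move=> a0 b0.
pose f (p : R * R) : \bar R :=
  (w a p.2 * w b (p.1 - p.2) * w 1 (1 - p.1))%:E.
have mf : measurable_fun setT f.
  apply/measurable_EFinP; apply: measurable_funM; first apply: measurable_funM.
  - exact: (measurableT_comp (measurable_power_density a)).
  - apply: (measurableT_comp (measurable_power_density b)).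
    exact: measurable_funB.
  - apply: (measurableT_comp (measurable_power_density 1)).
    exact: measurable_funB.
have f0 p : (0 <= f p)%E by rewrite lee_fin !mulr_ge0// power_density_ge0.
transitivity (\int[mu]_s \int[mu]_x f (s, x))%E.
  apply/esym.
  under eq_integral => s _.
    rewrite /f/=; under eq_integral do rewrite mulrC EFinM.
    rewrite ge0_integralZl//; last 3 first.
    - exact: measurable_power_conv_integrand.
    - by move=> x _; exact: power_conv_integrand_ge0.
    - by rewrite lee_fin power_density_ge0.
    rewrite -/(power_conv a b s) power_convE muleA [X in (X * _)%E]muleC -EFinM.
    rewrite muleC.
    over.
  rewrite ge0_integralZl//; last 3 first.
  - exact: measurable_power_conv_integrand.
  - by move=> x _; exact: power_conv_integrand_ge0.
  - exact: ebeta_ge0.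
  by rewrite -/(power_conv _ _ 1) -/(ebeta _ _) ebeta_1// addr_gt0.
transitivity (\int[mu]_x \int[mu]_s f (s, x))%E; first exact: fubini_tonelli.
under eq_integral => x _.
  rewrite /f/=; under eq_integral do rewrite -mulrA EFinM.
  rewrite ge0_integralZl//; last 3 first.
  - apply/measurable_EFinP; apply: measurable_funM; last first.
      exact: measurable_power_densityB.
    apply: (measurableT_comp (measurable_power_density b)).
    exact: measurable_funB.
  - by move=> s _; rewrite lee_fin mulr_ge0// power_density_ge0.
  - by rewrite lee_fin power_density_ge0.
  (* Translating [s] by [x] turns the inner integral into the convolution of the densities of
     exponents [b] and 1 at [1 - x]. *)
  rewrite (@ge0_integral_scale_shift _ 1 x)//; last 2 first.
  - apply/measurable_EFinP; apply: measurable_funM; last first.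
      exact: measurable_power_densityB.
    apply: (measurableT_comp (measurable_power_density b)).
    exact: measurable_funB.
  - by move=> s; rewrite lee_fin mulr_ge0// power_density_ge0.
  under eq_integral => s _.
    rewrite mul1r addrK (_ : 1 - (s + x) = 1 - x - s); last by ring.
    over.
  rewrite mul1e -/(power_conv b 1 (1 - x)) power_convE ebeta_1// muleA -EFinM.
  rewrite mulrC EFinM.
  over.
rewrite ge0_integralZl//; last 3 first.
- exact: measurable_power_conv_integrand.
- by move=> x _; exact: power_conv_integrand_ge0.
- by rewrite lee_fin invr_ge0 ltW.
by rewrite muleC.
Qed.

Lemma ebeta_nonincreasingr a b c : b <= c -> (ebeta a c <= ebeta a b)%E.
Proof.
move=> bc; apply: ge0_le_integral => //.
- by move=> x _; exact: power_conv_integrand_ge0.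
- exact: measurable_power_conv_integrand.
- exact: measurable_power_conv_integrand.
move=> x _; rewrite lee_fin {1 3}/w; case: ifPn => x0; last by rewrite !mul0r.
rewrite ler_wpM2l ?powR_ge0// power_density_nonincreasing//.
by rewrite gerBl ltW.
Qed.

(** Monotonicity bounds [ebeta a (b + 1)] by [ebeta a 1], which is finite. By [ebeta_assoc], a
    positive multiple of [ebeta a b] is then finite, which excludes the value [+oo]. *)
Lemma ebeta_fin_num a b : 0 < a -> 0 < b -> ebeta a b \is a fin_num.
Proof.
move=> a0 b0.
have fin_Sb : ebeta a (b + 1) \is a fin_num.
  rewrite ge0_fin_numE ?ebeta_ge0//.
  rewrite (le_lt_trans (@ebeta_nonincreasingr a 1 (b + 1) _))//.
    by rewrite lerDr ltW.
  by rewrite ebeta_1// ltry.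
have : (ebeta a b * ((a + b)^-1)%:E)%E \is a fin_num.
  by rewrite ebeta_assoc// fin_numM.
have : (0 <= ebeta a b)%E by exact: ebeta_ge0.
case: (ebeta a b) => //= _.
by rewrite gt0_mulye// lte_fin invr_gt0 addr_gt0.
Qed.

Definition beta a b : R := fine (ebeta a b).

Lemma ebetaE a b : 0 < a -> 0 < b -> ebeta a b = (beta a b)%:E.
Proof. by move=> a0 b0; rewrite fineK// ebeta_fin_num. Qed.

Lemma power_conv_beta a b s : 0 < a -> 0 < b ->
  power_conv a b s = (beta a b * w (a + b) s)%:E.
Proof. by move=> a0 b0; rewrite power_convE ebetaE// -EFinM mulrC. Qed.

Lemma beta_sym a b : beta a b = beta b a.
Proof. by rewrite /beta ebeta_sym. Qed.

Lemma beta_addr a b : 0 < a -> 0 < b -> beta a (b + 1) = b / (a + b) * beta a b.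
Proof.
move=> a0 b0; have b1 : 0 < b + 1 by rewrite addr_gt0.
have := ebeta_assoc a b a0 b0.
rewrite (ebetaE a b a0 b0) (ebetaE a (b + 1) a0 b1) -!EFinM => -[].
move: (beta a b) (beta a (b + 1)) => x y xy.
have -> : y = b * (y / b) by field; rewrite gt_eqF.
by rewrite -xy; ring.
Qed.

Lemma beta_addl a b : 0 < a -> 0 < b -> beta (a + 1) b = a / (a + b) * beta a b.
Proof.
move=> a0 b0.
by rewrite (beta_sym (a + 1) b) (beta_addr b a b0 a0) (beta_sym b a) (addrC b a).
Qed.

(** Positivity at integer [b] follows from the recurrence; a general [b] lies below some integer,
    and [ebeta] is nonincreasing in its second argument. *)
Lemma beta_gt0 a b : 0 < a -> 0 < b -> 0 < beta a b.
Proof.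
move=> a0 b0.
have beta_nat n : 0 < beta a n.+1%:R.
  elim: n => [|n IHn]; first by rewrite /beta ebeta_1//= invr_gt0.
  by rewrite -natr1 beta_addr// mulr_gt0// divr_gt0// addr_gt0.
have M0 : 0 < (Num.truncn b).+1%:R :> R by rewrite ltr0n.
apply: lt_le_trans (beta_nat (Num.truncn b)) _.
rewrite -lee_fin -(ebetaE a b a0 b0) -(ebetaE a _ a0 M0).
by apply: ebeta_nonincreasingr; rewrite ltW// Num.Theory.truncnS_gt.
Qed.

End PowerConvolution.

(** * Dirichlet integrals in the chart *)

Section VecIntegral.
Local Open Scope classical_set_scope.
Local Open Scope ring_scope.
Context {R : realType}.
Local Notation mu := (@lebesgue_measure R).
Local Notation w := power_density.
Local Notation coord := Defs.coord.

Lemma coord_vec_cons0 m (x : R) (t : vec R m) : coord (vec_cons (x, t)) ord0 = x.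
Proof. by rewrite /coord tnth0. Qed.

Lemma coord_vec_consS m (x : R) (t : vec R m) i :
  coord (vec_cons (x, t)) (lift ord0 i) = coord t i.
Proof. by rewrite /coord tnthS. Qed.

Lemma ge0_integral_lebesgue_vecS m (f : vec R m.+1 -> \bar R) :
  measurable_fun setT f -> (forall t, 0 <= f t)%E ->
  (\int[lebesgue_vec R m.+1]_t f t =
   \int[mu]_x \int[lebesgue_vec R m]_t f (vec_cons (x, t)))%E.
Proof.
move=> mf f0.
transitivity (\int[pushforward (mu \x lebesgue_vec R m) (@vec_cons R m)]_t f t)%E.
  by [].
rewrite (ge0_integral_pushforward (@measurable_vec_cons R m))//.
rewrite preimage_setT fubini_tonelli1//; last by move=> p; exact: f0.
apply: (measurableT_comp mf).
exact: measurable_vec_cons.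
Qed.

Lemma ge0_integral_lebesgue_vec0 (f : vec R 0 -> \bar R) :
  measurable_fun setT f -> (\int[lebesgue_vec R 0]_t f t = f [tuple])%E.
Proof. by move=> mf; rewrite integral_dirac// diracT mul1e. Qed.

(* The Dirichlet kernel includes the boundary of the simplex, where
   [0 `^ 0 = 1]; [power_density] vanishes at 0, which makes the convolution
   identity valid everywhere. *)
Definition closed_power_density (a x : R) : R :=
  if 0 <= x then x `^ (a - 1) else 0.
Local Notation v := closed_power_density.

Lemma closed_power_density_ge0 a x : 0 <= v a x.
Proof. by rewrite /v; case: ifP => // _; exact: powR_ge0. Qed.

Lemma measurable_closed_power_density a : measurable_fun setT (v a).
Proof.
apply: measurable_fun_if => //.
- by apply: measurable_fun_ler.
- by apply: measurable_funTS; exact: measurable_powR.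
Qed.

Lemma closed_power_densityE a x : x != 0 -> v a x = w a x.
Proof. by move=> x0; rewrite /v /w lt_neqAle eq_sym x0. Qed.

(** The Dirichlet kernel in the coordinates of the chart, for total mass [s] instead of 1:
    integrating out one coordinate [x] leaves mass [s - x], so the induction needs all [s]. *)
Definition dirichlet_chart (m : nat) (a : nat -> R) (s : R) (t : vec R m) : R :=
  \prod_(i < m) v (a i) (coord t i) * v (a m) (s - \sum_(i < m) coord t i).

Lemma dirichlet_chart_ge0 m a s (t : vec R m) : 0 <= dirichlet_chart m a s t.
Proof.
rewrite mulr_ge0 ?closed_power_density_ge0//.
by apply: prodr_ge0 => i _; exact: closed_power_density_ge0.
Qed.

Lemma measurable_dirichlet_chart m a s :
  measurable_fun setT (dirichlet_chart m a s).
Proof.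
apply: measurable_funM.
  apply: measurable_prod => i _.
  apply: (measurableT_comp (measurable_closed_power_density _)).
  exact: measurable_tnth.
apply: (measurableT_comp (measurable_closed_power_density _)).
apply: measurable_funB => //; apply: measurable_sum => i.
exact: measurable_tnth.
Qed.

Lemma dirichlet_chart_cons m a s x (t : vec R m) :
  dirichlet_chart m.+1 a s (vec_cons (x, t)) =
  v (a 0) x * dirichlet_chart m (fun i => a i.+1) (s - x) t.
Proof.
rewrite /dirichlet_chart !big_ord_recl coord_vec_cons0 -mulrA; congr (_ * (_ * _)).
  by apply: eq_bigr => i _; rewrite coord_vec_consS.
rewrite opprD addrA; congr (v _ (_ - _)).
by apply: eq_bigr => i _; rewrite coord_vec_consS.
Qed.

(* [multibeta m a] is [prod Gamma(a_i) / Gamma(sum a_i)] over [i <= m]. *)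
Fixpoint multibeta (m : nat) (a : nat -> R) : R :=
  if m is m'.+1 then
    beta (a 0) (\sum_(i < m) a i.+1) * multibeta m' (fun i => a i.+1)
  else 1.

Lemma sum_ord_gt0 m (a : 'I_m.+1 -> R) : (forall i, 0 < a i) -> 0 < \sum_(i < m.+1) a i.
Proof.
move=> a0; rewrite big_ord_recl ltr_pwDl//.
by apply: sumr_ge0 => i _; exact: ltW.
Qed.

Lemma multibeta_gt0 m a : (forall i, 0 < a i) -> 0 < multibeta m a.
Proof.
elim: m a => [//|m IHm] a a0 /=.
by rewrite mulr_gt0 ?IHm// beta_gt0// sum_ord_gt0.
Qed.

(** Raising [a 0] affects only the head beta factor. Raising a later exponent also raises the tail
    sum [A] by one; the head factor then gains [A / (a 0 + A)], whose numerator cancels the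
    denominator of the induction hypothesis. *)
Lemma multibeta_incr m a i : (forall i, 0 < a i) -> (i <= m)%N ->
  multibeta m (fun j => a j + (j == i)%:R) =
  a i / (\sum_(j < m.+1) a j) * multibeta m a.
Proof.
elim: m a i => [|m IHm] a i a0.
  by rewrite leqn0 => /eqP ->; rewrite big_ord1 divff ?mulr1// gt_eqF.
have A0 := sum_ord_gt0 m (fun i => a i.+1) (fun i => a0 i.+1).
case: i => [_|i im] /=.
  have -> : (fun i => a i.+1 + (i.+1 == 0)%:R) = (fun i => a i.+1).
    by apply/funext => i; rewrite addr0.
  under eq_bigr do rewrite addr0.
  by rewrite beta_addl// [in RHS]big_ord_recl mulrA.
have -> : (fun j => a j.+1 + (j.+1 == i.+1)%:R) = (fun j => a j.+1 + (j == i)%:R).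
  by [].
rewrite (IHm (fun i => a i.+1))// big_split/= addr0.
have -> : \sum_(j < m.+1) (j.+1 == i.+1)%:R = 1 :> R.
  rewrite (bigD1 (Ordinal im))//= eqxx big1 ?addr0// => j.
  by rewrite -val_eqE/= eqSS => /negbTE ->.
rewrite beta_addr// [in RHS]big_ord_recl /=.
set A := \sum_(j < m.+1) _ in A0 *.
by field; rewrite !gt_eqF// addr_gt0.
Qed.

(* For [s = 0] this fails: with [m = 0] and [a 0 = 1] the left-hand side is 1 and
   the right-hand side 0. *)
Lemma integral_dirichlet_chart m a s : (forall i, 0 < a i) -> s != 0 ->
  (\int[lebesgue_vec R m]_t (dirichlet_chart m a s t)%:E =
   (multibeta m a * w (\sum_(i < m.+1) a i) s)%:E)%E.
Proof.
elim: m a s => [|m IHm] a s a0 s0.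
  rewrite ge0_integral_lebesgue_vec0; last first.
    by apply/measurable_EFinP; exact: measurable_dirichlet_chart.
  by rewrite /dirichlet_chart !big_ord0 subr0 big_ord1 closed_power_densityE.
rewrite ge0_integral_lebesgue_vecS; last 2 first.
- by apply/measurable_EFinP; exact: measurable_dirichlet_chart.
- by move=> t; rewrite lee_fin dirichlet_chart_ge0.
pose A := \sum_(i < m.+1) a i.+1.
pose K := multibeta m (fun i => a i.+1).
have K0 : 0 < K by exact: multibeta_gt0.
transitivity (\int[mu]_x (K%:E * (w (a 0) x * w A (s - x))%:E))%E.
  apply: ge0_ae_eq_integral => //.
  - apply: (measurable_fun_fubini_tonelli_F
      (fun p => (dirichlet_chart m.+1 a s (vec_cons p))%:E)) => [|p].
      apply/measurable_EFinP.
      apply: (measurableT_comp (measurable_dirichlet_chart m.+1 a s)).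
      exact: measurable_vec_cons.
    by rewrite lee_fin dirichlet_chart_ge0.
  - by apply: measurable_funeM; exact: measurable_power_conv_integrand.
  - by move=> x _; apply: integral_ge0 => t _; rewrite lee_fin dirichlet_chart_ge0.
  - move=> x _; rewrite mule_ge0 ?power_conv_integrand_ge0//.
    by rewrite lee_fin ltW.
  - have null1 y : (mu [set y] = 0)%E by exact: lebesgue_measure_set1.
    exists ([set 0] `|` [set s]); split; first exact: measurableU.
      by rewrite measureU0; [exact: null1|exact: measurable_set1|
                             exact: measurable_set1|exact: null1].
    move=> x /=; apply: contra_notP => /not_orP[/eqP x0 /eqP xs] _.
    have sx : s - x != 0 by rewrite subr_eq0 eq_sym.
    under eq_integral do rewrite dirichlet_chart_cons EFinM.
    rewrite ge0_integralZl//; last 3 first.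
    - by apply/measurable_EFinP; exact: measurable_dirichlet_chart.
    - by move=> t _; rewrite lee_fin dirichlet_chart_ge0.
    - by rewrite lee_fin closed_power_density_ge0.
    by rewrite IHm// closed_power_densityE// -!EFinM mulrCA.
rewrite ge0_integralZl//; last 3 first.
- exact: measurable_power_conv_integrand.
- by move=> x _; exact: power_conv_integrand_ge0.
- by rewrite lee_fin ltW.
rewrite -/(power_conv _ _ _) power_conv_beta ?sum_ord_gt0//.
by rewrite -EFinM mulrA [K * _]mulrC [in RHS]big_ord_recl.
Qed.

End VecIntegral.

(** * Dirichlet integrals on the simplex *)

Section Simplex.
Local Open Scope classical_set_scope.
Local Open Scope ring_scope.
Context {R : realType}.
Local Notation coord := Defs.coord.

Lemma measurable_coord k (i : 'I_k) :
  measurable_fun setT (fun t : vec R k => coord t i).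
Proof. exact: measurable_tnth. Qed.

Lemma measurable_simplex k : measurable (@simplex R k).
Proof.
have -> : @simplex R k =
    \bigcap_(i in [set: 'I_k]) ((fun t => coord t i) @^-1` `[0, +oo[) `&`
    (fun t : vec R k => \sum_(i < k) coord t i) @^-1` [set 1].
  apply/seteqP; split => t [t0 t1]; split => // i.
    by move=> _ /=; rewrite in_itv/= t0.
  by have := t0 i I; rewrite /= in_itv/= andbT.
have mpre (f : vec R k -> R) (A : set R) :
    measurable_fun setT f -> measurable A -> measurable (f @^-1` A).
  by move=> mf mA; rewrite -[X in measurable X]setTI; exact: mf.
apply: measurableI; last first.
  apply: mpre; last exact: measurable_set1.
  by apply: measurable_sum => i; exact: measurable_coord.
apply: fin_bigcap_measurable; first exact: finite_finset.
move=> i _; apply: mpre; first exact: measurable_coord.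
exact: measurable_itv.
Qed.

Lemma ge0_integral_simplex_volume m (f : vec R m.+1 -> \bar R) :
  measurable_fun setT f -> (forall t, simplex t -> 0 <= f t)%E ->
  (\int[@simplex_volume R m.+1]_(t in @simplex R m.+1) f t =
   (Num.sqrt m.+1%:R)%:E *
   \int[lebesgue_vec R m]_(u in @chart R m.+1 @^-1` @simplex R m.+1)
     f (@chart R m.+1 u))%E.
Proof.
move=> mf f0; have mS := measurable_simplex m.+1.
have mf' : measurable_fun (@simplex R m.+1) f by exact: measurable_funTS.
rewrite /simplex_volume ge0_integral_mscale//.
congr (_ * _)%E.
transitivity (\int[pushforward (lebesgue_vec R m) (@chart R m.+1)]_(t in
  @simplex R m.+1) f t)%E.
  by [].
rewrite (ge0_integral_pushforward (@measurable_chart R m.+1))//.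
by move=> t; rewrite inE; exact: f0.
Qed.

Lemma coord_chart_widen m (u : vec R m) (i : 'I_m) :
  coord (@chart R m.+1 u) (widen_ord (leqnSn m) i) = coord u i.
Proof. by rewrite /coord tnth_mktuple (tnth_nth (1 - \sum_j coord u j)). Qed.

Lemma coord_chart_max m (u : vec R m) :
  coord (@chart R m.+1 u) ord_max = 1 - \sum_j coord u j.
Proof. by rewrite /coord tnth_mktuple nth_default// size_tuple. Qed.

Lemma dirichlet_kernel_ge0 k a (t : vec R k) : 0 <= dirichlet_kernel a t.
Proof. by apply: prodr_ge0 => i _; exact: powR_ge0. Qed.

Lemma measurable_dirichlet_kernel k (a : 'I_k -> R) :
  measurable_fun setT (dirichlet_kernel a).
Proof.
apply: measurable_prod => i _; apply: (measurableT_comp (measurable_powR _)).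
exact: measurable_coord.
Qed.

(** Points of the chart always have coordinate sum 1, so a point outside the simplex has a negative
    coordinate, and the corresponding closed density vanishes there. *)
Lemma dirichlet_kernel_chart m (a : nat -> R) :
  ((fun u => dirichlet_kernel (fun i : 'I_m.+1 => a i) (@chart R m.+1 u))
     \_ (@chart R m.+1 @^-1` @simplex R m.+1)) =
  dirichlet_chart m a 1.
Proof.
apply/funext => u; rewrite patchE; case: ifPn.
  rewrite inE/= => -[u0 _]; rewrite /dirichlet_kernel/= big_ord_recr/=.
  rewrite coord_chart_max /dirichlet_chart.
  congr (_ * _).
    apply: eq_bigr => i _; rewrite coord_chart_widen /closed_power_density.
    by rewrite -(coord_chart_widen m u) u0.
  by rewrite /closed_power_density -(coord_chart_max m u) u0.
(* By contraposition: if no factor vanishes, all coordinates are nonnegative and the point is in the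
   simplex. *)
rewrite notin_setE/= => nu; apply/esym/eqP; rewrite mulf_eq0.
apply/negPn/negP; rewrite negb_or => /andP[/prodf_neq0 u0 v0].
apply: nu; split.
  move=> i; have [im|mi] := ltnP i m.
    have -> : i = widen_ord (leqnSn m) (Ordinal im) by exact/val_inj.
    rewrite coord_chart_widen leNgt; apply/negP => ui.
    have := u0 (Ordinal im) isT.
    by rewrite /closed_power_density leNgt ui eqxx.
  have -> : i = ord_max by apply/val_inj/eqP; rewrite eqn_leq -ltnS ltn_ord.
  rewrite coord_chart_max leNgt; apply/negP => ui.
  by move: v0; rewrite /closed_power_density leNgt ui eqxx.
rewrite big_ord_recr/= coord_chart_max.
under eq_bigr do rewrite coord_chart_widen.
by rewrite addrC subrK.
Qed.

Lemma eq_integral_dirichlet_kernel m (a : nat -> R) : (forall i, 0 < a i) ->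
  (\int[@simplex_volume R m.+1]_(t in @simplex R m.+1)
     (dirichlet_kernel (fun i : 'I_m.+1 => a i) t)%:E =
   (Num.sqrt m.+1%:R * multibeta m a)%:E)%E.
Proof.
move=> a0; rewrite ge0_integral_simplex_volume; last 2 first.
- by apply/measurable_EFinP; exact: measurable_dirichlet_kernel.
- by move=> t _; rewrite lee_fin dirichlet_kernel_ge0.
rewrite integral_mkcond.
rewrite [X in integral _ _ X](_ : _ = EFin \o dirichlet_chart m a 1); last first.
  by rewrite -dirichlet_kernel_chart -restrict_EFin.
rewrite integral_dirichlet_chart ?oner_neq0//.
by rewrite /power_density ltr01 powR1 mulr1 EFinM.
Qed.

Section Positive.
Context {k : nat} (k_gt0 : (0 < k)%N) (a : 'I_k -> R) (a_gt0 : forall i, 0 < a i).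

Lemma simplex_integrable_dirichlet_kernel :
  (@simplex_volume R k).-integrable (@simplex R k) (EFin \o dirichlet_kernel a).
Proof.
case: k k_gt0 a a_gt0 => // m _ b b0.
apply/integrableP; split.
  by apply: measurable_funTS; apply/measurable_EFinP; exact: measurable_dirichlet_kernel.
under eq_integral do rewrite gee0_abs ?lee_fin ?dirichlet_kernel_ge0//.
(* The exponents are extended through [inord] to a positive sequence on [nat], the form that
   [multibeta] recurses on. *)
have -> : b = (fun i : 'I_m.+1 => b (inord i)).
  by apply/funext => i; rewrite inord_val.
by rewrite (eq_integral_dirichlet_kernel m (fun i => b (inord i)))// ltry.
Qed.

Lemma simplex_integral_dirichlet_kernel_gt0 :
  0 < simplex_integral (dirichlet_kernel a).
Proof.
case: k k_gt0 a a_gt0 => // m _ b b0.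
have -> : b = (fun i : 'I_m.+1 => b (inord i)).
  by apply/funext => i; rewrite inord_val.
rewrite /simplex_integral /Rintegral.
rewrite (eq_integral_dirichlet_kernel m (fun i => b (inord i)))//=.
by rewrite mulr_gt0 ?sqrtr_gt0 ?ltr0n// multibeta_gt0.
Qed.

Lemma simplex_integral_dirichlet_kernel_incr (i : 'I_k) :
  simplex_integral (dirichlet_kernel (fun j => a j + (j == i)%:R)) =
  a i / (\sum_j a j) * simplex_integral (dirichlet_kernel a).
Proof.
case: k k_gt0 a a_gt0 i => // m _ b b0 i.
pose c n := b (inord n : 'I_m.+1).
have bE : b = (fun i : 'I_m.+1 => c i).
  by apply/funext => j; rewrite /c inord_val.
have -> : (fun j => b j + (j == i)%:R) = (fun j : 'I_m.+1 => c j + (j == i :> nat)%:R).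
  by apply/funext => j; rewrite bE.
rewrite {2 3}bE.
have c0 j : 0 < c j by exact: b0.
have ci0 j : 0 < c j + (j == i)%:R by rewrite ltr_pwDl.
rewrite /simplex_integral /Rintegral (eq_integral_dirichlet_kernel m c c0)/=.
rewrite (eq_integral_dirichlet_kernel m (fun j => c j + (j == i)%:R) ci0)/=.
by rewrite multibeta_incr ?leq_ord// mulrCA /c inord_val.
Qed.

End Positive.

End Simplex.

(** * Multinomial moments and risk *)

Section Counts.
Local Open Scope classical_set_scope.
Local Open Scope ring_scope.
Context {k : nat}.
Implicit Types (n : nat) (i j : 'I_k).

Lemma sum_count_of {n} (c : counts k n) : (\sum_(j < k) count_of c j)%N = n.
Proof. exact/eqP/(valP c). Qed.

Lemma count_of_inj {n} (c d : counts k n) : count_of c =1 count_of d -> c = d.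
Proof. by move=> cd; apply/val_inj/ffunP => j; exact/val_inj/cd. Qed.

Lemma incr_count_subproof {n} i (c : counts k n) :
  (\sum_(j < k) [ffun j => inord (count_of c j + (j == i)) : 'I_n.+2] j == n.+1)%N.
Proof.
apply/eqP; transitivity (\sum_(j < k) (count_of c j + (j == i)))%N.
  apply: eq_bigr => j _; rewrite ffunE inordK//.
  by rewrite ltnS -addn1 leq_add ?leq_ord//; case: eqP.
rewrite big_split/= sum_count_of (bigD1 i)//= eqxx big1 ?addn1//.
by move=> j /negbTE ->.
Qed.

Definition incr_count {n} i (c : counts k n) : counts k n.+1 :=
  exist (fun d : {ffun 'I_k -> 'I_n.+2} => \sum_(j < k) d j == n.+1)%N _
    (incr_count_subproof i c).

Lemma count_of_incr {n} i (c : counts k n) j :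
  count_of (incr_count i c) j = (count_of c j + (j == i))%N.
Proof.
rewrite /count_of/= ffunE inordK//.
by rewrite ltnS -addn1 leq_add ?leq_ord//; case: eqP.
Qed.

(** Partial inverse of [incr_count i], in the form expected by [reindex_omap]; only its values at
    vectors with a positive [i]-th count matter. *)
Definition decr_count {n} i (c : counts k n.+1) : option (counts k n) :=
  insub [ffun j => inord (count_of c j - (j == i))].

Lemma decr_countK {n} i (c : counts k n.+1) : (0 < count_of c i)%N ->
  omap (incr_count i) (decr_count i c) = Some c.
Proof.
move=> ci0.
have cS : (\sum_(j < k) (count_of c j - (j == i)) = n)%N.
  apply: succn_inj; rewrite -[RHS](sum_count_of c).
  rewrite (bigD1 i)//= eqxx [in RHS](bigD1 i)//= -addSn subn1 prednK//.
  by congr addn; apply: eq_bigr => j /negbTE ->; rewrite subn0.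
(* Each decremented count is at most their sum [n], so [inord] does not alter it. *)
have cn j : (count_of c j - (j == i) < n.+1)%N.
  by rewrite ltnS -[X in (_ <= X)%N]cS (bigD1 j)//= leq_addr.
have dP : (\sum_(j < k) [ffun j => inord (count_of c j - (j == i)) : 'I_n.+1] j
    == n)%N.
  rewrite -[X in _ == X]cS; apply/eqP/eq_bigr => j _.
  by rewrite ffunE inordK.
rewrite /decr_count.
rewrite (insubT (fun d : {ffun 'I_k -> 'I_n.+1} => \sum_j d j == n)%N dP)/=.
 congr Some; apply: count_of_inj => j.
rewrite count_of_incr {1}/count_of /= ffunE inordK// subnK//.
by case: eqP => [->|].
Qed.

Lemma incr_countK {n} i (c : counts k n) :
  decr_count i (incr_count i c) = Some c.
Proof.
rewrite /decr_count (_ : [ffun _ => _] = val c) ?valK//.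
apply/ffunP => j; rewrite ffunE count_of_incr addnK; apply/val_inj.
by rewrite /= inordK// ltn_ord.
Qed.

End Counts.

(** * Multinomial moments by size biasing, and the quadratic risk *)

Section Multinomial.
Local Open Scope classical_set_scope.
Local Open Scope ring_scope.
Context {R : realType} {k : nat} (t : vec R k).
Local Notation coord := Defs.coord.

(* Size biasing: [c_i n!/c! = n (n-1)!/(c - e_i)!]. *)
Lemma multinomial_expectation_size_bias n i (F : ('I_k -> nat) -> R) :
  multinomial_expectation t
    (fun c : counts k n.+1 => (count_of c i)%:R * F (count_of c)) =
  n.+1%:R * coord t i * multinomial_expectation t
    (fun c : counts k n => F (fun j => count_of c j + (j == i))%N).
Proof.
rewrite /multinomial_expectation.
rewrite (bigID (fun c : counts k n.+1 => 0 < count_of c i)%N)/=.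
rewrite [X in _ + X]big1 ?addr0; last first.
  by move=> c; rewrite lt0n negbK => /eqP ->; rewrite mul0r mulr0.
rewrite (reindex_omap (incr_count i) (decr_count i)); last first.
  by move=> c; exact: decr_countK.
rewrite mulr_sumr; apply: eq_big => [c|c _].
  by rewrite incr_countK eqxx andbT count_of_incr eqxx addn1.
have -> : count_of (incr_count i c) = (fun j => count_of c j + (j == i))%N.
  by apply/funext => j; rewrite count_of_incr.
have factE : (\prod_j (count_of (incr_count i c) j)`! =
    (count_of c i).+1 * \prod_j (count_of c j)`!)%N.
  rewrite (bigD1 i)//= [in RHS](bigD1 i)//= mulnA -factS count_of_incr eqxx addn1.
  by congr muln; apply: eq_bigr => j /negbTE ji; rewrite count_of_incr ji addn0.
have powE : \prod_j coord t j ^+ count_of (incr_count i c) j =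
    coord t i * \prod_j coord t j ^+ count_of c j.
  rewrite (bigD1 i)//= [in RHS](bigD1 i)//= mulrA -exprS count_of_incr eqxx addn1.
  by congr *%R; apply: eq_bigr => j /negbTE ji; rewrite count_of_incr ji addn0.
rewrite /multinomial_pmf factE powE factS eqxx addn1 !natrM.
set P := (\prod_(_ < k) _)%N.
have P0 : P%:R != 0 :> R.
  by rewrite pnatr_eq0 -lt0n prodn_gt0// => j; exact: fact_gt0.
have c0 : (count_of c i).+1%:R != 0 :> R by rewrite pnatr_eq0.
rewrite !invfM; set p := P%:R^-1; set m := (_.+1)%:R in c0 *.
by field.
Qed.

Lemma multinomial_expectationD n (f g : counts k n -> R) :
  multinomial_expectation t (fun c => f c + g c) =
  multinomial_expectation t f + multinomial_expectation t g.
Proof. by rewrite -big_split; apply: eq_bigr => c _; rewrite mulrDr. Qed.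

Lemma multinomial_expectationZ n a (f : counts k n -> R) :
  multinomial_expectation t (fun c => a * f c) =
  a * multinomial_expectation t f.
Proof. by rewrite mulr_sumr; apply: eq_bigr => c _; rewrite mulrCA. Qed.

Lemma multinomial_expectation_sum n (I : finType) (f : I -> counts k n -> R) :
  multinomial_expectation t (fun c => \sum_i f i c) =
  \sum_i multinomial_expectation t (f i).
Proof. by rewrite exchange_big; apply: eq_bigr => c _; rewrite mulr_sumr. Qed.

Hypothesis t1 : \sum_i coord t i = 1.

(** Induction replaces the multinomial theorem: the counts sum to [n.+1], so [n.+1] times the total
    mass is the sum of the means, and size biasing reduces each mean to the total mass for [n]. *)
Lemma multinomial_expectation1 n :
  multinomial_expectation t (fun _ : counts k n => 1) = 1.
Proof.
elim: n => [|n IHn].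
  (* For an empty sample the zero vector is the only outcome, with mass 1. *)
  have count0 (c : counts k 0) j : count_of c j = 0%N.
    by apply/eqP; rewrite -leqn0 -ltnS ltn_ord.
  have P0 : (\sum_(j < k) [ffun=> ord0 : 'I_1] j == 0)%N.
    by rewrite big1// => j _; rewrite ffunE.
  pose c0 : counts k 0 :=
    exist (fun d : {ffun 'I_k -> 'I_1} => \sum_j d j == 0)%N _ P0.
  rewrite /multinomial_expectation (bigD1 c0)//= big1 => [|c /eqP[]]; last first.
    by apply: count_of_inj => j; rewrite !count0.
  rewrite addr0 mulr1 /multinomial_pmf big1 => [|j _]; last by rewrite count0.
  by rewrite big1 ?divr1 ?mulr1// => j _; rewrite count0.
have n0 : n.+1%:R != 0 :> R by rewrite pnatr_eq0.
apply: (mulfI n0); rewrite -multinomial_expectationZ.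
transitivity (multinomial_expectation t
    (fun c : counts k n.+1 => \sum_i (count_of c i)%:R * 1 : R)).
  congr multinomial_expectation; apply/funext => c.
  by rewrite -mulr_suml -natr_sum sum_count_of.
rewrite multinomial_expectation_sum.
under eq_bigr do rewrite (multinomial_expectation_size_bias _ _ (fun=> 1)) IHn mulr1.
by rewrite -mulr_sumr t1.
Qed.

Lemma multinomial_expectation_cst n (a : R) :
  multinomial_expectation t (fun _ : counts k n => a) = a.
Proof.
by rewrite -[RHS]mulr1 -(multinomial_expectation1 n) -multinomial_expectationZ mulr1.
Qed.

Lemma multinomial_mean n i :
  multinomial_expectation t (fun c : counts k n => (count_of c i)%:R) =
  n%:R * coord t i.
Proof.
case: n => [|n].
  rewrite mul0r /multinomial_expectation big1// => c _.
  by rewrite (_ : count_of c i = 0%N) ?mulr0//; apply/eqP; rewrite -leqn0 -ltnS ltn_ord.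
transitivity (multinomial_expectation t
    (fun c : counts k n.+1 => (count_of c i)%:R * 1)).
  by congr multinomial_expectation; apply/funext => c; rewrite mulr1.
by rewrite (multinomial_expectation_size_bias _ _ (fun=> 1)) multinomial_expectation1 mulr1.
Qed.

(** Size biasing removes one factor [c_i] and leaves the mean of [c_i + 1] for a sample with one
    observation less. The case of the empty sample is separate. *)
Lemma multinomial_second_moment n i :
  multinomial_expectation t (fun c : counts k n => (count_of c i)%:R ^+ 2) =
  n%:R * coord t i * (1 + (n%:R - 1) * coord t i).
Proof.
case: n => [|n].
  rewrite !mul0r /multinomial_expectation big1// => c _.
  rewrite (_ : count_of c i = 0%N) ?expr0n ?mulr0//.
  by apply/eqP; rewrite -leqn0 -ltnS ltn_ord.
rewrite (multinomial_expectation_size_bias _ _ (fun c => (c i)%:R)).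
congr (_ * _); transitivity (multinomial_expectation t
    (fun c : counts k n => (count_of c i)%:R + 1)).
  by congr multinomial_expectation; apply/funext => c; rewrite eqxx natrD.
rewrite multinomial_expectationD multinomial_mean multinomial_expectation1.
by rewrite -natr1 addrK addrC.
Qed.

Lemma risk_shrinkage n (C : R) : n%:R + k%:R * C != 0 ->
  risk (fun (c : counts k n) i => ((count_of c i)%:R + C) / (n%:R + k%:R * C)) t =
  (n%:R * (1 - \sum_i coord t i ^+ 2) +
   C ^+ 2 * (k%:R ^+ 2 * \sum_i coord t i ^+ 2 - k%:R)) /
  (n%:R + k%:R * C) ^+ 2.
Proof.
move=> N0; rewrite /risk multinomial_expectation_sum.
set N := n%:R + _ in N0 *.
(* Variance plus squared bias, coordinatewise: the bias of coordinate [i] is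
   [C * (1 - k%:R * coord t i) / N]. *)
transitivity (\sum_(i < k) (n%:R * (coord t i - coord t i ^+ 2) +
    C ^+ 2 * (1 - k%:R * coord t i) ^+ 2) / N ^+ 2).
  apply: eq_bigr => i _.
  (* The nonrandom part of the error, which is [c_i / N + b]. *)
  pose b := C / N - coord t i.
  transitivity (multinomial_expectation t (fun c : counts k n =>
      (N ^+ 2)^-1 * (count_of c i)%:R ^+ 2 +
      (2 * b / N * (count_of c i)%:R + b ^+ 2))).
    congr multinomial_expectation; apply/funext => c; rewrite /b.
    by field.
  rewrite 2!multinomial_expectationD 2!multinomial_expectationZ.
  rewrite multinomial_second_moment multinomial_mean multinomial_expectation_cst.
  by rewrite /b /N in N0 *; field.
rewrite -mulr_suml; congr (_ / _).
rewrite big_split/= -!mulr_sumr sumrB t1; congr (_ + _ * _).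
transitivity (\sum_(i < k) (1 - 2 * k%:R * coord t i + k%:R ^+ 2 * coord t i ^+ 2)).
  by apply: eq_bigr => i _; ring.
rewrite big_split sumrB/= sumr_const card_ord -!mulr_sumr t1.
by ring.
Qed.
End Multinomial.

(** * Bayes estimator and average risk *)

Section DirichletMoments.
Local Open Scope classical_set_scope.
Local Open Scope ring_scope.
Context {R : realType} {k : nat}.
Local Notation coord := Defs.coord.
Implicit Types (a : 'I_k -> R) (t : vec R k) (f g : vec R k -> R).

(** The delicate point is [x = 0] with a positive power: [0 < c] makes the exponent on the right
    nonzero, so both sides vanish. *)
Lemma exprn_powR (x c : R) n : 0 <= x -> 0 < c ->
  x ^+ n * x `^ (c - 1) = x `^ (c + n%:R - 1).
Proof.
move=> x0 c0; case: n => [|n]; first by rewrite mul1r addr0.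
have [->|xn0] := eqVneq x 0.
  rewrite expr0n/= mul0r powR0// -natr1 addrA addrK gt_eqF//.
  by rewrite ltr_pwDl.
rewrite -powR_mulrn// -powRD; last by rewrite xn0 implybT.
by congr (_ `^ _); ring.
Qed.

Lemma dirichlet_kernel_exprM a (c : 'I_k -> nat) t :
  (forall i, 0 < a i) -> simplex t ->
  (\prod_i coord t i ^+ c i) * dirichlet_kernel a t =
  dirichlet_kernel (fun i => a i + (c i)%:R) t.
Proof.
move=> a0 [t0 _]; rewrite /dirichlet_kernel -big_split/=.
by apply: eq_bigr => i _; rewrite exprn_powR.
Qed.

Lemma dirichlet_kernel_coordM a i t :
  (forall i, 0 < a i) -> simplex t ->
  coord t i * dirichlet_kernel a t =
  dirichlet_kernel (fun j => a j + (j == i)%:R) t.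
Proof.
move=> a0 tS; rewrite -dirichlet_kernel_exprM//; congr (_ * _).
by rewrite (bigD1 i)//= eqxx big1 ?mulr1// => j /negbTE ->.
Qed.

Lemma dirichlet_kernel1 t : dirichlet_kernel (fun=> 1) t = 1.
Proof. by rewrite /dirichlet_kernel big1// => i _; rewrite subrr powRr0. Qed.

Lemma eq_simplex_integral f g : (forall t, simplex t -> f t = g t) ->
  simplex_integral f = simplex_integral g.
Proof. by move=> fg; apply: eq_Rintegral => t; rewrite inE; exact: fg. Qed.

Hypothesis k_gt0 : (0 < k)%N.

Lemma simplex_integral_dirichlet_kernelZ a (c : R) : (forall i, 0 < a i) ->
  simplex_integral (fun t => c * dirichlet_kernel a t) =
  c * simplex_integral (dirichlet_kernel a).
Proof.
move=> a0; apply: RintegralZl; first exact: measurable_simplex.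
exact: simplex_integrable_dirichlet_kernel.
Qed.

(** Conjugacy: on the simplex, likelihood times prior is a constant times the kernel with exponents
    [C + c_j]. The posterior mean is thus a ratio of two Dirichlet integrals differing by one unit
    in exponent [i]. *)
Lemma bayes_dirichletE n (C : R) (c : counts k n) i : 0 < C ->
  @bayes_dirichlet R k n C c i =
  ((count_of c i)%:R + C) / (n%:R + k%:R * C).
Proof.
move=> C0; pose a j := C + (count_of c j)%:R.
have a0 j : 0 < a j by rewrite ltr_pwDl.
have I0 := simplex_integral_dirichlet_kernel_gt0 k_gt0 a a0.
have Z0 := simplex_integral_dirichlet_kernel_gt0 k_gt0 (fun=> C) (fun=> C0).
(* The multinomial coefficient over the normalizing integral of the prior; it cancels in the
   posterior. *)
pose M : R := n`!%:R / (\prod_(i < k) (count_of c i)`!)%N%:R /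
  simplex_integral (@dirichlet_kernel R k (fun=> C)).
have M0 : 0 < M.
  rewrite !divr_gt0// ltr0n ?fact_gt0// prodn_gt0// => j.
  exact: fact_gt0.
have priorE t : simplex t ->
    multinomial_pmf t c * dirichlet_density (fun=> C) t = M * dirichlet_kernel a t.
  move=> tS; rewrite /a -dirichlet_kernel_exprM// /multinomial_pmf /M.
  by rewrite /dirichlet_density; ring.
rewrite /bayes_dirichlet /bayes_estimator /posterior_density.
rewrite (eq_simplex_integral _ _ priorE) simplex_integral_dirichlet_kernelZ//.
set I := simplex_integral (dirichlet_kernel a) in I0 *.
transitivity (simplex_integral (fun t =>
    I^-1 * dirichlet_kernel (fun j => a j + (j == i)%:R) t)).
  apply: eq_simplex_integral => t tS.
  rewrite priorE// -dirichlet_kernel_coordM//.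
  by field; rewrite !gt_eqF.
rewrite simplex_integral_dirichlet_kernelZ; last by move=> j; rewrite ltr_pwDl.
rewrite simplex_integral_dirichlet_kernel_incr// -/I mulrCA mulVf ?gt_eqF// mulr1.
congr (_ / _); first by rewrite /a addrC.
rewrite /a big_split/= sumr_const card_ord -natr_sum sum_count_of -[C *+ _]mulr_natl.
by rewrite addrC.
Qed.

(** Constants and squared coordinates are Dirichlet kernels with exponents 1, respectively 1 raised
    twice at [i], so the recurrence gives every integral as a multiple of the volume [V]. *)
Lemma simplex_average_sum_sqr (al be : R) f :
  (forall t, simplex t -> f t = al + be * \sum_i coord t i ^+ 2) ->
  simplex_average f = al + be * (2 / (k%:R + 1)).
Proof.
move=> fE; rewrite /simplex_average (eq_simplex_integral _ _ fE).
have k0 : 0 < k%:R :> R by rewrite ltr0n.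
have k1 : 0 < k%:R + 1 :> R by rewrite ltr_wpDl.
have one_gt0 (i : 'I_k) : 0 < 1 :> R by [].
pose V := simplex_integral (@dirichlet_kernel R k (fun=> 1)).
have V0 : 0 < V by exact: simplex_integral_dirichlet_kernel_gt0.
have mS := measurable_simplex (R := R) k.
have volE : fine (simplex_volume R k (@simplex R k)) = V.
  rewrite /V (eq_simplex_integral _ (fun=> 1)); last first.
    by move=> t _; exact: dirichlet_kernel1.
  by rewrite /simplex_integral Rintegral_cst// mul1r.
pose e1 (i : 'I_k) := fun j : 'I_k => 1 + (j == i)%:R : R.
pose e2 (i : 'I_k) := fun j : 'I_k => e1 i j + (j == i)%:R : R.
have e1_gt0 i j : 0 < e1 i j by rewrite ltr_pwDl.
have e2_gt0 i j : 0 < e2 i j by rewrite ltr_pwDl.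
have sqrE i t : simplex t -> coord t i ^+ 2 = dirichlet_kernel (e2 i) t.
  move=> tS; rewrite /e2 -dirichlet_kernel_coordM// /e1 -dirichlet_kernel_coordM//.
  by rewrite dirichlet_kernel1 mulr1 expr2.
(* Raising exponent [i] from 1 to 2 gives the factor [1 / k], and from 2 to 3 the factor
   [2 / (k + 1)]. *)
have intsqr i : simplex_integral (dirichlet_kernel (e2 i)) =
    2 / (k%:R * (k%:R + 1)) * V.
  rewrite (simplex_integral_dirichlet_kernel_incr k_gt0 (e1 i) (e1_gt0 i)).
  rewrite (simplex_integral_dirichlet_kernel_incr k_gt0 _ one_gt0) -/V.
  rewrite /e1 eqxx big_split/= sumr_const card_ord (bigD1 i)//= eqxx big1 ?addr0; last first.
    by move=> j /negbTE ->.
  by rewrite mulr1n; field; rewrite !gt_eqF.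
pose mu := simplex_volume R k.
have int1 a : (forall i, 0 < a i) ->
    mu.-integrable (@simplex R k) (EFin \o dirichlet_kernel a).
  by move=> a0; exact: simplex_integrable_dirichlet_kernel.
have intS : mu.-integrable (@simplex R k)
    (EFin \o (fun t => \sum_i dirichlet_kernel (e2 i) t)).
  have -> : EFin \o (fun t => \sum_i dirichlet_kernel (e2 i) t) =
      (fun t => \sum_(i <- index_enum 'I_k) (dirichlet_kernel (e2 i) t)%:E)%E.
    by apply/funext => t /=; rewrite sumEFin.
  by apply: integrable_sum => // i _; exact: int1.
have intSE : simplex_integral (fun t => \sum_i dirichlet_kernel (e2 i) t) =
    \sum_i simplex_integral (dirichlet_kernel (e2 i)).
  rewrite /simplex_integral /Rintegral; under eq_integral do rewrite -sumEFin.
  rewrite integral_sum//; last by move=> i; exact: int1.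
  rewrite -sum_fine//; last by move=> i _; apply: integrable_fin_num => //; exact: int1.
transitivity (simplex_integral (fun t => al * dirichlet_kernel (fun=> 1) t +
    be * \sum_i dirichlet_kernel (e2 i) t) / V).
  rewrite volE; congr (_ / _); apply: eq_simplex_integral => t tS.
  rewrite dirichlet_kernel1 mulr1; congr (_ + _ * _).
  by apply: eq_bigr => i _; exact: sqrE.
rewrite /simplex_integral RintegralD//; last 2 first.
- exact: (integrableZl mS al (int1 _ one_gt0)).
- exact: (integrableZl mS be intS).
rewrite !RintegralZl//; last exact: int1.
rewrite -!/(simplex_integral _) -/V intSE.
under eq_bigr do rewrite intsqr.
rewrite sumr_const card_ord -[X in be * X]mulr_natl.
by field; rewrite !gt_eqF.
Qed.

(** The risk is affine in the sum of squares, so only the average of that sum enters. Assuming just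
    a nonzero denominator lets [C = 0] cover the maximum likelihood estimator. *)
Lemma average_risk_shrinkage n (C : R) (d : estimator R k n) :
  n%:R + k%:R * C != 0 ->
  (forall c i, d c i = ((count_of c i)%:R + C) / (n%:R + k%:R * C)) ->
  average_risk d =
  (k%:R - 1) / (k%:R + 1) * ((n%:R + k%:R * C ^+ 2) / (n%:R + k%:R * C) ^+ 2).
Proof.
move=> N0 dE; rewrite /average_risk.
have -> : d = (fun c i => ((count_of c i)%:R + C) / (n%:R + k%:R * C)).
  by apply/funext => c; apply/funext => i; exact: dE.
have k1 : k%:R + 1 != 0 :> R by rewrite natr1 pnatr_eq0.
rewrite (simplex_average_sum_sqr
  ((n%:R - C ^+ 2 * k%:R) / (n%:R + k%:R * C) ^+ 2)
  ((C ^+ 2 * k%:R ^+ 2 - n%:R) / (n%:R + k%:R * C) ^+ 2)).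
  by field; rewrite N0.
by move=> t [_ t1]; rewrite risk_shrinkage//; field.
Qed.

End DirichletMoments.

(** * The relative decrease in average risk and its maximum *)

Theorem mainTheorem3 (R : realType) (k n : nat) (hk : (2 <= k)%N)
    (hn : (1 <= n)%N) :
  (forall C : R, 0 < C ->
     relative_decrease k n C =
       1 - n%:R * (k%:R * C ^+ 2 + n%:R) / (k%:R * C + n%:R) ^+ 2) /\
  (forall C : R, 0 < C -> relative_decrease k n C <= relative_decrease k n 1) /\
  relative_decrease k n (1 : R) = k%:R / (k%:R + n%:R).
Proof.
have k_gt0 : (0 < k)%N by exact: ltnW.
have n0 : 0 < n%:R :> R by rewrite ltr0n.
have k0 : 0 < k%:R :> R by rewrite ltr0n.
have k1 : 0 < k%:R - 1 :> R by rewrite subr_gt0 ltr1n.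
have formula (C : R) : 0 < C -> relative_decrease k n C =
    1 - n%:R * (k%:R * C ^+ 2 + n%:R) / (k%:R * C + n%:R) ^+ 2.
  move=> C0; have N0 : 0 < n%:R + k%:R * C by rewrite addr_gt0// mulr_gt0.
  rewrite /relative_decrease.
  rewrite (average_risk_shrinkage k_gt0 n C (bayes_dirichlet C)) ?gt_eqF//; last first.
    by move=> c i; exact: bayes_dirichletE.
  rewrite (average_risk_shrinkage k_gt0 n 0 (@mle R k n)); last 2 first.
  - by rewrite mulr0 addr0 gt_eqF.
  - by move=> c i; rewrite /mle mulr0 !addr0.
  (* The common factor [(k - 1) / (k + 1)] cancels, being nonzero for [k >= 2]. *)
  by field; rewrite [_ * C + _]addrC !gt_eqF// addr_gt0.
have value1 : relative_decrease k n (1 : R) = k%:R / (k%:R + n%:R).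
  by rewrite (formula 1 ltr01); field; rewrite gt_eqF// addr_gt0.
split; first exact: formula.
split; last exact: value1.
move=> C C0; rewrite value1 (formula C C0) -subr_ge0.
have N0 : 0 < k%:R * C + n%:R by rewrite addr_gt0// mulr_gt0.
have kn0 : 0 < k%:R + n%:R :> R by rewrite addr_gt0.
(* Over the common denominator this rests on [(k C^2 + n)(k + n) - (k C + n)^2 = k n (C - 1)^2]. *)
rewrite (_ : _ - _ = n%:R ^+ 2 * k%:R * (C - 1) ^+ 2 /
    ((k%:R + n%:R) * (k%:R * C + n%:R) ^+ 2)).
  apply: divr_ge0; last by apply: mulr_ge0; [exact: ltW|exact: sqr_ge0].
  apply: mulr_ge0; last exact: sqr_ge0.
  by apply: mulr_ge0; [exact: sqr_ge0|exact: ltW].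
by field; rewrite !gt_eqF.
Qed.
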